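(* Every elliptical (third-order) jet of a surface in $A^3$ can be transformed by an affine transformation in $Aff(3)$ to one of the standard forms $$z(x,y)=\tfrac12(x^2+y^2)+\tfrac16(x^3-3xy^2)+\cdots$$ or $$z(x,y)=\tfrac12(x^2+y^2)+0+\cdots$$ at the origin, where $\cdots$ denotes terms of order at least $4$ (in the second form the cubic part is zero).
   Context: $A^3$ is real affine 3-space with affine coordinates $x,y,z$, and $Aff(3)$ is the group of all affine transformations of $A^3$. Surfaces are locally written as graphs $z=z(x,y)$; the jet of order 3 of a surface at a point is its equivalence class under contact of order 3 at that point, i.e. it is given by the point and the Taylor polynomial of order 3 of $z(x,y)$ there, and $Aff(3)$ acts on such jets. By affine transformations any jet can be brought to the origin with zero linear part and quadratic part equal to one of $\frac12(x^2+y^2)$, $\frac12(x^2-y^2)$, $\frac12x^2$, $0$; the jet is called elliptical if the quadratic part so obtained is $\frac12(x^2+y^2)$. *)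

(* Defs.v *)
From mathcomp Require Import all_boot all_order all_algebra.
From mathcomp Require Import reals.
From mathcomp Require Import mpoly.

Set Implicit Arguments.
Unset Strict Implicit.
Unset Printing Implicit Defensive.

Import GRing.Theory.

Local Open Scope ring_scope.

Section Jets.
Variable R : realType.

(* [taylor_eq k p q] says that p and q have the same Taylor polynomial of
   order k at 0, i.e. that they differ by terms of order at least k.+1. *)
Definition taylor_eq (n k : nat) (p q : {mpoly R[n]}) : Prop :=
  forall m : 'X_{1..n}, (mdeg m <= k)%N -> p@_m = q@_m.

Definition jacobian0 (m n : nat) (g : 'cV[{mpoly R[n]}]_m) : 'M[R]_(m, n) :=
  \matrix_(i, j) (g i 0)@_(U_(j))%MM.

(* A surface germ is given by a parametrization g = (x(u,v), y(u,v), z(u,v))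
   around (u,v) = (0,0). Only the terms of order at most 3 of the coordinate
   functions matter for a third-order jet, so that polynomials represent all
   jets, including those of surfaces with a vertical tangent plane; the point
   of the surface is the constant term of g. *)
Record surface_germ := SurfaceGerm {
  param :> 'cV[{mpoly R[2]}]_3;
  param_immersive : \rank (jacobian0 param) = 2%N }.

Definition is_reparam (phi : 'cV[{mpoly R[2]}]_2) : Prop :=
  (forall i, (phi i 0)@_0%MM = 0) /\ jacobian0 phi \in unitmx.

Definition substitute (p : {mpoly R[2]}) (phi : 'cV[{mpoly R[2]}]_2) :=
  p \mPo [tuple phi i 0 | i < 2].

(* Two surface germs have contact of order k when, up to a local
   diffeomorphism of the parameters, their parametrizations agree to order k.
   The third-order jet of a surface is its class under contact of order 3. *)
Definition contact (k : nat) (g h : surface_germ) : Prop :=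
  exists2 phi, is_reparam phi
    & forall i, taylor_eq k (g i 0) (substitute (h i 0) phi).

Definition same_jet3 : surface_germ -> surface_germ -> Prop := contact 3.

Record aff3 := Aff3 {
  aff_lin : 'M[R]_3;
  aff_trans : 'cV[R]_3;
  aff_unit : aff_lin \in unitmx }.

Definition aff_param (A : aff3) (g : 'cV[{mpoly R[2]}]_3) :
    'cV[{mpoly R[2]}]_3 :=
  map_mx (@mpolyC 2 R) (aff_lin A) *m g + map_mx (@mpolyC 2 R) (aff_trans A).

Lemma aff_param_immersive (A : aff3) (g : surface_germ) :
  \rank (jacobian0 (aff_param A g)) = 2%N.
Proof.
have -> : jacobian0 (aff_param A g) = aff_lin A *m jacobian0 g.
  apply/matrixP => i j; rewrite !mxE mcoeffD mcoeffC mnm1_eq0 mulr0 addr0.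
  rewrite (raddf_sum (mcoeff U_(j)%MM)); apply: eq_bigr => k _.
  by rewrite !mxE /= mcoeffCM.
rewrite -mxrank_tr trmx_mul mxrankMfree ?mxrank_tr ?param_immersive //.
by rewrite row_free_unit unitmx_tr; case: A.
Qed.

Definition aff_act (A : aff3) (g : surface_germ) : surface_germ :=
  SurfaceGerm (aff_param_immersive A g).

Definition X : {mpoly R[2]} := 'X_ord0.
Definition Y : {mpoly R[2]} := 'X_ord_max.

(* The graph z = T(x - a, y - b), as a germ at the point over (a, b). *)
Definition graph_param (a b : R) (T : {mpoly R[2]}) : 'cV[{mpoly R[2]}]_3 :=
  \col_(i < 3) [:: a%:MP + X; b%:MP + Y; T]`_i.

Lemma graph_immersive (a b : R) (T : {mpoly R[2]}) :
  \rank (jacobian0 (graph_param a b T)) = 2%N.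
Proof.
have J i j : jacobian0 (graph_param a b T) (widen_ord (isT : 2 <= 3)%N i) j
             = (i == j)%:R.
  rewrite !mxE; case: i => -[|[|//]] lti; case: j => -[|[|//]] ltj /=.
  1-4: by rewrite mcoeffD mcoeffC mcoeffXU mnm1_eq0 mulr0 add0r.
apply/eqP; rewrite (eqn_leq (\rank _)) rank_leq_col /=.
apply: leq_trans (mxrankS (rowsub_sub (widen_ord (isT : 2 <= 3)%N) _)).
rewrite -{1}(mxrank1 R 2); apply: eq_leq; congr mxrank.
by apply/matrixP => i j; rewrite mxE [RHS]mxE J.
Qed.

Definition graph (a b : R) (T : {mpoly R[2]}) : surface_germ :=
  SurfaceGerm (graph_immersive a b T).

Lemma taylor_eqM n k (p p' q q' : {mpoly R[n]}) :
  taylor_eq k p p' -> taylor_eq k q q' -> taylor_eq k (p * q) (p' * q').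
Proof.
move=> hp hq m hm; rewrite !mcoeffM; apply: eq_bigr => -[m1 m2] /= /eqP /(congr1 mdeg).
rewrite mdegD => e; move: hm; rewrite [X in (X <= _)%N -> _]e => hm.
rewrite hp ?hq //; first exact: leq_trans (leq_addl _ _) hm.
exact: leq_trans (leq_addr _ _) hm.
Qed.

Lemma taylor_eq_substitute k (p : {mpoly R[2]}) (phi psi : 'cV_2) :
  (forall i, taylor_eq k (phi i 0) (psi i 0)) ->
  taylor_eq k (substitute p phi) (substitute p psi).
Proof.
move=> h; rewrite /substitute !comp_mpolyE.
elim/big_ind2: _ => // [p1 p2 q1 q2 h1 h2 m hm|m _].
  by rewrite !mcoeffD h1 ?h2.
move=> l hl; rewrite !mcoeffZ; congr (_ * _); move: l hl.
elim/big_ind2: _ => // [p1 p2 q1 q2|i _]; first exact: taylor_eqM.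
rewrite !tnth_mktuple; elim: (m i) => // d IH; rewrite !exprS.
exact: taylor_eqM.
Qed.

(* The jet of a graph amounts to its point and its Taylor polynomial. *)
Lemma same_jet3_graphP (a b a' b' : R) (S T : {mpoly R[2]}) :
  same_jet3 (graph a b S) (graph a' b' T)
  <-> [/\ a = a', b = b' & taylor_eq 3 S T].
Proof.
pose id2 : 'cV[{mpoly R[2]}]_2 := \col_i 'X_i.
have id2K p : substitute p id2 = p.
  rewrite -[RHS]comp_mpoly_id; congr comp_mpoly.
  by apply: eq_from_tnth => i; rewrite !tnth_mktuple mxE.
split=> [[phi [phi0 _] h]|[-> -> h]]; last first.
  exists id2; first split=> [i|].
  - by rewrite mxE mcoeffX mnm1_eq0.
  - rewrite (_ : jacobian0 _ = 1%:M) ?unitmx1 //.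
    by apply/matrixP => i j; rewrite !mxE mcoeffXU.
  by move=> i; rewrite id2K !mxE; case: i => -[|[|[|//]]] /=.
have lin (c c' : R) (i : 'I_2) :
    taylor_eq 3 (c%:MP + 'X_i) (substitute (c'%:MP + 'X_i) phi) ->
    c = c' /\ taylor_eq 3 'X_i (phi i 0).
  rewrite /substitute rmorphD /= comp_mpolyC comp_mpolyXU -tnth_nth tnth_mktuple => e.
  have ec : c = c'.
    move: (e 0%MM); rewrite mdeg0 => /(_ isT).
    rewrite !mcoeffD !mcoeffC eqxx !mulr1 phi0 mcoeffX mnm1_eq0.
    by rewrite !addr0.
  by split=> // m /e; rewrite ec !mcoeffD => /addrI.
have [ea e0] : a = a' /\ taylor_eq 3 X (phi ord0 0).
  by apply: lin; have := h 0; rewrite !mxE.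
have [eb e1] : b = b' /\ taylor_eq 3 Y (phi ord_max 0).
  by apply: lin; have := h 1; rewrite !mxE.
split=> // m hm; have := h ord_max m hm; rewrite !mxE /= => ->.
rewrite -[in RHS](id2K T); apply: (@taylor_eq_substitute 3) => // i l hl.
rewrite !mxE; case: i => -[|[|//]] lti.
- have -> : Ordinal lti = ord0 by exact: val_inj.
  by rewrite -(e0 l hl).
- have -> : Ordinal lti = ord_max by exact: val_inj.
  by rewrite -(e1 l hl).
Qed.

Definition elliptic_quadric : {mpoly R[2]} := 2^-1 *: (X ^+ 2 + Y ^+ 2).

(* Vanishing of the constant and linear terms of T puts the transformed jet at
   the origin with zero linear part; the cubic part of T is arbitrary. *)
Definition elliptical (g : surface_germ) : Prop :=
  exists (A : aff3) (T : {mpoly R[2]}),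
    same_jet3 (aff_act A g) (graph 0 0 T) /\ taylor_eq 2 T elliptic_quadric.

End Jets.

Arguments X {R}.
Arguments Y {R}.
Arguments elliptic_quadric {R}.

(* Main.v *)
(** Put the jet as z = (x^2+y^2)/2 + C(x,y). The shear (x,y,z) -> (x+az, y+bz, z)
    changes C by -(ax+by)(x^2+y^2)/2 modulo order 4, so that a suitable choice of
    (a,b) leaves only the harmonic part of C, which is
    p(x^3-3xy^2) + r(3x^2y-y^3). This has a real linear factor, and a similarity
    of the (x,y)-plane taking the line where it vanishes to the y-axis makes it a
    multiple of x^3-3xy^2. Finally (x,y,z) -> (lam x, lam y, lam^2 z) divides this
    cubic by lam and preserves the quadratic part.
    With U + iV = (1-it)(x+iy), the quadratic part is multiplied by 1+t^2, which is
    compensated in z; this spares the normalization of rotations. *)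
Require Import Defs.
From mathcomp Require Import all_boot all_order all_algebra.
From mathcomp Require Import reals mpoly.
From mathcomp Require Import ring lra.

Set Implicit Arguments.
Unset Strict Implicit.
Unset Printing Implicit Defensive.

Import Order.TTheory GRing.Theory Num.Theory.

Local Open Scope ring_scope.

(** * Orders of vanishing at the origin *)

(** Membership in the d-th power of the maximal ideal of the origin. Truncation errors are then
    estimated by adding the orders of factors instead of comparing coefficients. *)
Definition vanishes (R : realType) (n d : nat) (p : {mpoly R[n]}) : Prop :=
  forall m : 'X_{1..n}, (mdeg m < d)%N -> p@_m = 0.

Section Vanishing.
Variables (R : realType) (n : nat).
Implicit Types (p q : {mpoly R[n]}) (c d k : nat).

Lemma taylor_eq_vanishes k p q : taylor_eq k p q <-> vanishes k.+1 (p - q).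
Proof.
split=> h m hm; first by rewrite mcoeffB h ?subrr.
by apply/eqP; rewrite -subr_eq0 -mcoeffB h.
Qed.

Lemma vanishes0 d : vanishes d (0 : {mpoly R[n]}).
Proof. by move=> m _; rewrite mcoeff0. Qed.

Lemma vanishesW c d p : (c <= d)%N -> vanishes d p -> vanishes c p.
Proof. by move=> cd h m hm; apply: h; apply: leq_trans cd. Qed.

Lemma vanishesD d p q : vanishes d p -> vanishes d q -> vanishes d (p + q).
Proof. by move=> hp hq m hm; rewrite mcoeffD hp ?hq ?addr0. Qed.

Lemma vanishesN d p : vanishes d p -> vanishes d (- p).
Proof. by move=> hp m hm; rewrite mcoeffN hp ?oppr0. Qed.

Lemma vanishesB d p q : vanishes d p -> vanishes d q -> vanishes d (p - q).
Proof. by move=> hp hq; apply/vanishesD/vanishesN. Qed.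

Lemma vanishesM c d p q :
  vanishes c p -> vanishes d q -> vanishes (c + d) (p * q).
Proof.
move=> hp hq m hm; rewrite mcoeffM big1 // => -[m1 m2] /= /eqP/(congr1 mdeg).
rewrite mdegD => em.
have [/hp->|le1] := ltnP (mdeg m1) c; first by rewrite mul0r.
have [/hq->|le2] := ltnP (mdeg m2) d; first by rewrite mulr0.
by move: hm; rewrite [X in (X < _)%N]em ltnNge leq_add.
Qed.

Lemma vanishesMl d p q : vanishes d q -> vanishes d (p * q).
(* Vanishing to order 0 is no condition on [p]. *)
Proof. by apply: (@vanishesM 0). Qed.

Lemma vanishesX c k p : vanishes c p -> vanishes (k * c) (p ^+ k).
Proof.
by move=> hp; elim: k => // k IH; rewrite exprS mulSn; apply: vanishesM.
Qed.

Lemma taylor_eq_refl k p : taylor_eq k p p. Proof. by []. Qed.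

Lemma taylor_eq_trans k q p r :
  taylor_eq k p q -> taylor_eq k q r -> taylor_eq k p r.
Proof. by move=> h1 h2 m hm; rewrite h1 ?h2. Qed.

Lemma taylor_eqD k p p' q q' :
  taylor_eq k p p' -> taylor_eq k q q' -> taylor_eq k (p + q) (p' + q').
Proof. by move=> h1 h2 m hm; rewrite !mcoeffD h1 ?h2. Qed.

End Vanishing.

(** * Substitution of parameters and contact with graphs *)

Section Reparametrization.
Variable R : realType.
Implicit Types (p q : {mpoly R[2]}) (phi : 'cV[{mpoly R[2]}]_2).

(** A monomial of degree at least [d] becomes a product of at least [d] factors vanishing at the
    origin; the lower monomials have coefficient zero in [p]. *)
Lemma vanishes_substitute d p phi :
  (forall i, vanishes 1 (phi i 0)) -> vanishes d p ->
  vanishes d (substitute p phi).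
Proof.
move=> hphi hp; rewrite /substitute comp_mpolyE.
elim/big_rec: _ => [|m q _ hq]; first exact: vanishes0.
apply: vanishesD hq; have [lt_md|le_dm] := ltnP (mdeg m) d.
  by rewrite hp // scale0r; apply: vanishes0.
rewrite -mul_mpolyC; apply: vanishesMl; apply: vanishesW le_dm _.
rewrite mdegE; elim/big_rec2: _ => // i k s _; apply: vanishesM.
by rewrite tnth_mktuple -[X in vanishes X](muln1 (m i)); apply: vanishesX.
Qed.

Lemma taylor_eq_substitutel k p q phi :
  (forall i, vanishes 1 (phi i 0)) -> taylor_eq k p q ->
  taylor_eq k (substitute p phi) (substitute q phi).
Proof.
move=> hphi /taylor_eq_vanishes h; apply/taylor_eq_vanishes.
by rewrite /substitute -comp_mpolyB; apply: vanishes_substitute.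
Qed.

Lemma vanishes1P p : p@_0%MM = 0 -> vanishes 1 p.
Proof. by move=> h m; rewrite ltnS leqn0 mdeg_eq0 => /eqP->. Qed.

Lemma substituteX phi : substitute X phi = phi ord0 0.
Proof. by rewrite /substitute /X comp_mpolyXU -tnth_nth tnth_mktuple. Qed.

Lemma substituteY phi : substitute Y phi = phi ord_max 0.
Proof. by rewrite /substitute /Y comp_mpolyXU -tnth_nth tnth_mktuple. Qed.

(** The horizontal coordinates of a graph over the origin are the parameters themselves, so contact
    forces [phi] to be the horizontal part of [g] up to order 3. *)
Lemma same_jet3_graph0 (g : surface_germ R) (T : {mpoly R[2]}) :
  same_jet3 g (graph 0 0 T) <->
  exists2 phi, is_reparam phi &
    [/\ taylor_eq 3 (g ord0 0) (phi ord0 0),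
        taylor_eq 3 (g 1 0) (phi ord_max 0) &
        taylor_eq 3 (g ord_max 0) (substitute T phi)].
Proof.
have e0 phi : substitute (graph 0 0 T ord0 0) phi = phi ord0 0.
  by rewrite mxE /= mpolyC0 add0r substituteX.
have e1 phi : substitute (graph 0 0 T 1 0) phi = phi ord_max 0.
  by rewrite mxE /= mpolyC0 add0r substituteY.
have e2 phi : substitute (graph 0 0 T ord_max 0) phi = substitute T phi.
  by rewrite mxE.
split=> -[phi rphi h]; exists phi => //.
  by split; [rewrite -e0|rewrite -e1|rewrite -e2]; apply: h.
case: h => h0 h1 h2 [[|[|[|//]]] lti].
- by rewrite (_ : Ordinal lti = ord0) ?e0 //; apply: val_inj.
- by rewrite (_ : Ordinal lti = 1) ?e1 //; apply: val_inj.
- by rewrite (_ : Ordinal lti = ord_max) ?e2 //; apply: val_inj.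
Qed.

End Reparametrization.

(** * Cubic Taylor polynomials and harmonic cubics *)

Lemma mnm2E (m : 'X_{1..2}) :
  m = (U_(ord0) *+ m ord0 + U_(ord_max) *+ m ord_max)%MM.
Proof.
apply/mnmP => -[[|[|//]] lti]; rewrite mnmDE !mulmnE !mnm1E.
  have -> : Ordinal lti = ord0 by exact: val_inj.
  by rewrite eqxx mul1n mul0n addn0.
have -> : Ordinal lti = ord_max by exact: val_inj.
by rewrite eqxx mul1n mul0n.
Qed.

Lemma mcoeff_XY (R : realType) (i j : nat) (m : 'X_{1..2}) :
  (X ^+ i * Y ^+ j : {mpoly R[2]})@_m = ((m ord0 == i) && (m ord_max == j))%:R.
Proof.
rewrite /X /Y !mpolyXn -mpolyXD mcoeffX; congr (nat_of_bool _)%:R.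
apply/eqP/andP => [<-|[/eqP<- /eqP<-]]; last by rewrite -mnm2E.
by rewrite !mnmDE !mulmnE !mnm1E !eqxx /= !mul1n !mul0n addn0 !eqxx.
Qed.

Lemma cubic_taylor (R : realType) (T : {mpoly R[2]}) :
  taylor_eq 2 T elliptic_quadric ->
  exists c0 c1 c2 c3 : R, taylor_eq 3 T
    (elliptic_quadric + (c0 *: X ^+ 3 + c1 *: (X ^+ 2 * Y)
                         + c2 *: (X * Y ^+ 2) + c3 *: Y ^+ 3)).
Proof.
move=> hT; pose c i j := T@_(U_(ord0) *+ i + U_(ord_max) *+ j)%MM.
exists (c 3 0), (c 2 1), (c 1 2), (c 0 3) => m hm.
have dm : mdeg m = (m ord0 + m ord_max)%N.
  by rewrite mdegE big_ord_recl big_ord1; congr (_ + m _)%N; apply: val_inj.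
have eX k : X ^+ k = X ^+ k * Y ^+ 0 :> {mpoly R[2]} by rewrite expr0 mulr1.
have eY k : Y ^+ k = X ^+ 0 * Y ^+ k :> {mpoly R[2]} by rewrite expr0 mul1r.
have cubE : (c 3 0 *: X ^+ 3 + c 2 1 *: (X ^+ 2 * Y) + c 1 2 *: (X * Y ^+ 2)
             + c 0 3 *: Y ^+ 3)@_m = if mdeg m == 3%N then T@_m else 0.
  have -> : T@_m = c (m ord0) (m ord_max) by rewrite {1}[m]mnm2E.
  rewrite dm eX (eY 3).
  rewrite -[X * _]/(X ^+ 1 * Y ^+ 2) -[X ^+ 2 * Y]/(X ^+ 2 * Y ^+ 1).
  rewrite !mcoeffD !mcoeffZ !mcoeff_XY; move: hm; rewrite dm; clearbody c.
  (* An exponent of 4 or more contradicts the degree bound, so finitely many monomials remain. *)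
  move: (m ord0) (m ord_max) => [|[|[|[|i]]]] [|[|[|[|j]]]] //= _;
    by rewrite ?mulr0 ?mulr1 ?addr0 ?add0r.
rewrite mcoeffD cubE; case: eqP => [d3|d3]; last first.
  by rewrite addr0 hT //; move: hm; rewrite leq_eqVlt => /orP[/eqP|].
suff -> : (elliptic_quadric : {mpoly R[2]})@_m = 0 by rewrite add0r.
rewrite mcoeffZ mcoeffD eX (eY 2) !mcoeff_XY; move: d3; rewrite dm.
by move: (m ord0) (m ord_max) => [|[|[|i]]] [|[|[|j]]] //=;
  rewrite ?addr0 ?mulr0 // addnC.
Qed.

(* The equations say that p + i r is a real multiple of (1 + i t)^3. *)
Lemma harmonic_cubic_axis (R : rcfType) (p r : R) :
  exists t mu : R, (1 + t ^+ 2) * p = mu * (1 - 3 * t ^+ 2)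
                /\ (1 + t ^+ 2) * r = mu * (3 * t - t ^+ 3).
Proof.
have [->|r0] := eqVneq r 0.
  by exists 0, p; split; ring.
(* Up to the factor r, this is the imaginary part of (p - ir)(1 + ix)^3; its vanishing makes p + ir
   a real multiple of (1 + ix)^3. The factor r fixes the signs: the values are -r^2 at 0 and 8r^2 at
   the square root of 3, where (1 + ix)^3 = -8. *)
pose f : {poly R} :=
  r *: ((3 * p) *: 'X - p *: 'X^3 - r%:P + (3 * r) *: 'X^2).
have fE x : f.[x] = r * (p * (3 * x - x ^+ 3) - r * (1 - 3 * x ^+ 2)).
  by rewrite /f !(hornerZ, hornerD, hornerN, hornerXn, hornerX, hornerC); ring.
have s3 : Num.sqrt (3 : R) ^+ 2 = 3 by rewrite sqr_sqrtr.
have [] := @poly_ivt R f 0 (Num.sqrt 3).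
- by rewrite sqrtr_ge0.
- have -> : f.[0] = - r ^+ 2 by rewrite fE; ring.
  have -> : f.[Num.sqrt 3] = 8 * r ^+ 2 by rewrite fE exprS s3; ring.
  by have := sqr_ge0 r; lra.
move=> t _; rewrite /root fE mulf_eq0 (negPf r0) /= subr_eq0 => /eqP ft.
have n0 : 1 + t ^+ 2 != 0 by have := sqr_ge0 t; lra.
(* The inner product of p + ir with (1 + it)^3, divided by the squared modulus (1 + t^2)^3 and
   multiplied by 1 + t^2. *)
exists t, ((p * (1 - 3 * t ^+ 2) + r * (3 * t - t ^+ 3)) / (1 + t ^+ 2) ^+ 2).
split; apply: (mulIf (expf_neq0 2 n0)); rewrite mulrAC [RHS]mulrAC divfK ?expf_neq0 //.
(* Both identities rest on (1 + t^2)^3 = (1 - 3t^2)^2 + (3t - t^3)^2. *)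
- transitivity (p * (1 - 3 * t ^+ 2) ^+ 2
                + (p * (3 * t - t ^+ 3)) * (3 * t - t ^+ 3)); first by ring.
  by rewrite ft; ring.
- transitivity (r * (3 * t - t ^+ 3) ^+ 2
                + (r * (1 - 3 * t ^+ 2)) * (1 - 3 * t ^+ 2)); first by ring.
  by rewrite -ft; ring.
Qed.

(** * Similarity, shear and scaling combined *)

(** [U0] + i [V0] and [a] + i [b] are P + iQ and l1 + i l2 multiplied by 1 - it, and [C] is the real
    part of (p - ir)(P + iQ)^3. The cross term of the squares cancels the multiple of [q] in the
    cubic part. Every term on the right has order at least 4 once [P] and [Q] have order 1. [h]
    stands for 1/2, so that only ring operations occur. *)
Lemma shear_cubic (K : comPzRingType) (h l1 l2 p r t mu P Q : K) :
  let q := h * (P ^+ 2 + Q ^+ 2) in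
  let C := p * (P ^+ 3 - 3 * (P * Q ^+ 2)) + r * (3 * (P ^+ 2 * Q) - Q ^+ 3) in
  let Z := q + ((l1 * P + l2 * Q) * q + C) in
  let a := l1 + t * l2 in
  let b := l2 - t * l1 in
  let U0 := P + t * Q in
  let V0 := Q - t * P in
  let U := U0 + a * Z in
  let V := V0 + b * Z in
  h * 2 = 1 ->
  (1 + t ^+ 2) * p = mu * (1 - 3 * t ^+ 2) ->
  (1 + t ^+ 2) * r = mu * (3 * t - t ^+ 3) ->
  (1 + t ^+ 2) * Z - (h * (U ^+ 2 + V ^+ 2) + mu * (U ^+ 3 - 3 * (U * V ^+ 2)))
  = - ((a * U0 + b * V0) * ((l1 * P + l2 * Q) * q + C))
    - h * (a ^+ 2 + b ^+ 2) * Z ^+ 2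
    - mu * Z * (a * (U ^+ 2 + U * U0 + U0 ^+ 2)
                - 3 * (a * V ^+ 2 + b * U0 * (V + V0))).
Proof.
move=> q C Z a b U0 V0 U V h2 hp hr.
have eC : (1 + t ^+ 2) * C = mu * (U0 ^+ 3 - 3 * (U0 * V0 ^+ 2)).
  by rewrite mulrDr !mulrA hp hr /U0 /V0; ring.
have eq0 : (1 + t ^+ 2) * q = h * (U0 ^+ 2 + V0 ^+ 2).
  by rewrite /q /U0 /V0; ring.
have el : (1 + t ^+ 2) * (l1 * P + l2 * Q) = a * U0 + b * V0.
  by rewrite /a /b /U0 /V0; ring.
(* Inserting [h * 2], which is 1, matches the cross terms of [h * (U ^+ 2 + V ^+ 2)]; the remaining
   identity then holds with [h] as an indeterminate. *)
have -> : (1 + t ^+ 2) * Z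
    = h * (U0 ^+ 2 + V0 ^+ 2) + (a * U0 + b * V0) * q * (h * 2)
      + mu * (U0 ^+ 3 - 3 * (U0 * V0 ^+ 2)).
  by rewrite -eC -eq0 -el h2 mulr1 /Z; ring.
have -> : (a * U0 + b * V0) * ((l1 * P + l2 * Q) * q + C)
    = (a * U0 + b * V0) * (Z - q) * (h * 2).
  by rewrite h2 mulr1 /Z [q + _]addrC addrK.
rewrite /U /V.
clearbody Z q U0 V0 a b; ring.
Qed.

(** Multiplication of x + iy by lam(1 - it), the shear and the scaling of z, composed in one map. *)
Definition shear_mx (R : realType) (lam t a b : R) : 'M[R]_3 :=
  \matrix_(i < 3, j < 3)
    (nth [::] [:: [:: lam; lam * t; lam * a];
                  [:: - (lam * t); lam; lam * b];
                  [:: 0; 0; lam ^+ 2 * (1 + t ^+ 2)]] i)`_j.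

(** The horizontal block of [shear_mx]: the factor by which the Jacobian of the parameters
    changes. *)
Definition similarity_mx (R : realType) (lam t : R) : 'M[R]_2 :=
  \matrix_(i < 2, j < 2)
    (nth [::] [:: [:: lam; lam * t]; [:: - (lam * t); lam]] i)`_j.

Lemma det_similarity_mx (R : realType) (lam t : R) :
  \det (similarity_mx lam t) = lam ^+ 2 * (1 + t ^+ 2).
Proof.
rewrite (expand_det_row _ ord0) !big_ord_recl big_ord0 /cofactor !det_mx11.
by rewrite !mxE /=; ring.
Qed.

Lemma det_shear_mx (R : realType) (lam t a b : R) :
  \det (shear_mx lam t a b) = (lam ^+ 2 * (1 + t ^+ 2)) ^+ 2.
Proof.
rewrite (expand_det_row _ ord_max) !big_ord_recl big_ord0 !mxE /= !mul0r !add0r addr0.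
rewrite /cofactor [\det _](_ : _ = lam ^+ 2 * (1 + t ^+ 2)).
  by rewrite -signr_odd /= mul1r -expr2.
rewrite -det_similarity_mx; congr determinant.
by apply/matrixP => -[[|[|//]] lti] [[|[|//]] ltj]; rewrite !mxE.
Qed.

Lemma mulmx3E (K : pzRingType) (M : 'M[K]_3) (G : 'cV[K]_3) i :
  (M *m G) i 0 = M i ord0 * G ord0 0 + M i 1 * G 1 0 + M i ord_max * G ord_max 0.
Proof.
rewrite mxE !big_ord_recl big_ord0 addr0 addrA.
by congr (_ + _ * _ + M i _ * G _ 0) => //;
  [congr (M i _)|congr (G _ 0)| |]; apply: val_inj.
Qed.

(** * Reduction to the normal forms *)

(** [lam * k] is the [mu] of [harmonic_cubic_axis], since the dilation by [lam] divides the cubic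
    coefficient by [lam]. Keeping [k] free covers both normal forms at once. *)
Lemma normalize_cubic (R : realType) (g : surface_germ R)
    (phi : 'cV[{mpoly R[2]}]_2) (l1 l2 p r t lam k : R) :
  let P := phi ord0 0 in let Q := phi ord_max 0 in
  let q := (2^-1)%:MP * (P ^+ 2 + Q ^+ 2) in
  let C := p%:MP * (P ^+ 3 - 3 * (P * Q ^+ 2))
           + r%:MP * (3 * (P ^+ 2 * Q) - Q ^+ 3) in
  let Z := q + ((l1%:MP * P + l2%:MP * Q) * q + C) in
  is_reparam phi -> taylor_eq 3 (g ord0 0) P -> taylor_eq 3 (g 1 0) Q ->
  taylor_eq 3 (g ord_max 0) Z ->
  lam != 0 ->
  (1 + t ^+ 2) * p = lam * k * (1 - 3 * t ^+ 2) ->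
  (1 + t ^+ 2) * r = lam * k * (3 * t - t ^+ 3) ->
  exists B : aff3 R, same_jet3 (aff_act B g)
    (graph 0 0 (2^-1 *: (X ^+ 2 + Y ^+ 2) + k *: (X ^+ 3 - 3 *: (X * Y ^+ 2)))).
Proof.
move=> P Q q C Z [phi0 Jphi] gP gQ gZ lam0 ep er.
have vP : vanishes 1 P by apply: vanishes1P; apply: phi0.
have vQ : vanishes 1 Q by apply: vanishes1P; apply: phi0.
have vq : vanishes 2 q.
  by apply/vanishesMl/vanishesD; apply: (@vanishesX _ _ 1 2).
have vl (a b : R) : vanishes 1 (a%:MP * P + b%:MP * Q).
  by apply: vanishesD; apply: vanishesMl.
have vC : vanishes 3 C.
  apply: vanishesD; apply: vanishesMl; apply: vanishesB.
  - exact: (@vanishesX _ _ 1 3).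
  - by apply/vanishesMl/(@vanishesM _ _ 1 2) => //; apply: (@vanishesX _ _ 1 2).
  - by apply/vanishesMl/(@vanishesM _ _ 2 1) => //; apply: (@vanishesX _ _ 1 2).
  - exact: (@vanishesX _ _ 1 3).
have vlC : vanishes 3 ((l1%:MP * P + l2%:MP * Q) * q + C).
  by apply: vanishesD vC; apply: (@vanishesM _ _ 1 2).
have vZ : vanishes 2 Z by apply: vanishesD => //; apply: vanishesW vlC.
pose a := l1 + t * l2; pose b := l2 - t * l1.
have n0 : lam ^+ 2 * (1 + t ^+ 2) != 0.
  rewrite mulf_neq0 ?expf_neq0 //; have := sqr_ge0 t; lra.
have uM : shear_mx lam t a b \in unitmx.
  by rewrite unitmxE det_shear_mx unitfE expf_neq0.
exists (Aff3 0 uM); apply/same_jet3_graph0.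
pose U := P + t%:MP * Q + a%:MP * Z; pose V := Q - t%:MP * P + b%:MP * Z.
(* The horizontal coordinates of the transformed germ, with those of [g] replaced by [P], [Q], [Z],
   which agree with them to order 3. *)
pose psi : 'cV[{mpoly R[2]}]_2 := \col_i [:: lam%:MP * U; lam%:MP * V]`_i.
have e0 : psi ord0 0 = lam%:MP * U by rewrite mxE.
have e1 : psi ord_max 0 = lam%:MP * V by rewrite mxE.
have gE i : aff_act (Aff3 0 uM) g i 0 = (shear_mx lam t a b i ord0)%:MP * g ord0 0
    + (shear_mx lam t a b i 1)%:MP * g 1 0
    + (shear_mx lam t a b i ord_max)%:MP * g ord_max 0.
  by rewrite /= /aff_param /= map_mx0 addr0 mulmx3E !mxE.
have teq x y z : taylor_eq 3 (x%:MP * g ord0 0 + y%:MP * g 1 0 + z%:MP * g ord_max 0)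
   (x%:MP * P + y%:MP * Q + z%:MP * Z).
  by do 2?apply: taylor_eqD; apply: taylor_eqM.
exists psi; [split|split].
- case=> [[|[|//]] lti].
  + rewrite mxE /= mcoeffCM (_ : U@_0 = 0) ?mulr0 //.
    rewrite !mcoeffD !mcoeffCM.
    by rewrite vP ?vQ ?vZ ?mdeg0 // !mulr0 !addr0.
  + rewrite mxE /= mcoeffCM (_ : V@_0 = 0) ?mulr0 //.
    rewrite !mcoeffD mcoeffN !mcoeffCM.
    by rewrite vP ?vQ ?vZ ?mdeg0 // !mulr0 oppr0 !addr0.
(* [Z] has no linear terms, so the shear does not affect the Jacobian. *)
- rewrite (_ : jacobian0 psi = similarity_mx lam t *m jacobian0 phi).
    by rewrite unitmx_mul Jphi unitmxE det_similarity_mx unitfE n0.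
  apply/matrixP => i j; rewrite !mxE !big_ord_recl big_ord0 !mxE.
  have -> : lift ord0 ord0 = ord_max :> 'I_2 by apply: val_inj.
  have zj : Z@_U_(j) = 0 by apply: vZ; rewrite mdeg1.
  case: i => [[|[|//]] lti] /=; rewrite mcoeffCM !mcoeffD ?mcoeffN
    !mcoeffCM zj -/P -/Q; ring.
- rewrite gE e0; apply: (taylor_eq_trans (teq _ _ _)).
  rewrite !mxE /= !rmorphM /= (_ : _ + _ = lam%:MP * U).
    exact: taylor_eq_refl.
  by rewrite /U; ring.
- rewrite gE e1; apply: (taylor_eq_trans (teq _ _ _)).
  rewrite !mxE /= rmorphN !rmorphM /= (_ : _ + _ = lam%:MP * V).
    exact: taylor_eq_refl.
  by rewrite /V; ring.
- rewrite gE; apply: (taylor_eq_trans (teq _ _ _)).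
  rewrite !mxE /= mpolyC0 !mul0r !add0r; apply/taylor_eq_vanishes.
  pose H := (2^-1)%:MP * (U ^+ 2 + V ^+ 2)
            + lam%:MP * k%:MP * (U ^+ 3 - 3 * (U * V ^+ 2)).
  have -> : substitute (2^-1 *: (X ^+ 2 + Y ^+ 2)
                        + k *: (X ^+ 3 - 3 *: (X * Y ^+ 2))) psi
            = lam%:MP ^+ 2 * H.
    have -> : 3 *: (X * Y ^+ 2) = 3 * (X * Y ^+ 2) :> {mpoly R[2]}.
      by rewrite scaler_nat mulr_natl.
    rewrite -!mul_mpolyC.
    rewrite /substitute !(rmorphD, rmorphN, rmorphXn, rmorphM, rmorph_nat) /=.
    rewrite !comp_mpolyC -!/(substitute _ psi) substituteX substituteY e0 e1.
    rewrite /H; ring.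
  have -> : (lam ^+ 2 * (1 + t ^+ 2))%:MP
            = lam%:MP ^+ 2 * (1 + t%:MP ^+ 2) :> {mpoly R[2]}.
    by rewrite rmorphM rmorphD !rmorphXn rmorph1.
  rewrite -mulrA -mulrBr; apply: vanishesMl.
  have h2 : (2^-1)%:MP * 2 = 1 :> {mpoly R[2]}.
    by rewrite -(rmorph_nat (@mpolyC 2 R)) -mpolyCM mulVf ?mpolyC1 ?pnatr_eq0.
  pose U0 := P + t%:MP * Q; pose V0 := Q - t%:MP * P.
  have -> : (1 + t%:MP ^+ 2) * Z - H
    = - ((a%:MP * U0 + b%:MP * V0) * ((l1%:MP * P + l2%:MP * Q) * q + C))
      - (2^-1)%:MP * (a%:MP ^+ 2 + b%:MP ^+ 2) * Z ^+ 2
      - lam%:MP * k%:MP * Z * (a%:MP * (U ^+ 2 + U * U0 + U0 ^+ 2)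
                - 3 * (a%:MP * V ^+ 2 + b%:MP * U0 * (V + V0))).
    rewrite /H /U /V /a /b mpolyCD mpolyCB !mpolyCM.
    apply: shear_cubic => //.
    + have /(congr1 (@mpolyC 2 R)) := ep.
      by rewrite !(rmorphM, rmorphD, rmorphN, rmorphXn, rmorph1, rmorph_nat).
    + have /(congr1 (@mpolyC 2 R)) := er.
      by rewrite !(rmorphM, rmorphD, rmorphN, rmorphXn, rmorph1, rmorph_nat).
  have vZ1 : vanishes 1 Z by apply: vanishesW vZ.
  have vU0 : vanishes 1 U0 by apply: vanishesD => //; apply: vanishesMl.
  have vV0 : vanishes 1 V0 by apply: vanishesB => //; apply: vanishesMl.
  have vU : vanishes 1 U by apply: vanishesD => //; apply: vanishesMl.
  have vV : vanishes 1 V by apply: vanishesD => //; apply: vanishesMl.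
  have v2 x y : vanishes 1 x -> vanishes 1 y -> vanishes 2 (x * y).
    exact: (@vanishesM _ _ 1 1).
  (* The three terms have orders at least 1 + 3, 2 * 2 and 2 + 2. *)
  apply: vanishesB; first apply: vanishesB.
  - by apply/vanishesN/(@vanishesM _ _ 1 3) => //; apply: vanishesD; apply: vanishesMl.
  - exact/vanishesMl/(@vanishesX _ _ 2 2).
  - apply: (@vanishesM _ _ 2 2); first exact: vanishesMl.
    apply: vanishesB; apply: vanishesMl.
      by rewrite !expr2; do 2?apply: vanishesD; apply: v2.
    apply: vanishesD; first by apply: vanishesMl; apply: v2.
    by apply: v2; [apply: vanishesMl|apply: vanishesD].
Qed.

Theorem theorem3p1 (R : realType) (g : surface_germ R) (hg : elliptical g) :
  exists A : aff3 R,
    same_jet3 (aff_act A g)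
      (graph 0 0 (2^-1 *: (X ^+ 2 + Y ^+ 2)
                  + 6^-1 *: (X ^+ 3 - 3 *: (X * Y ^+ 2))))
    \/ same_jet3 (aff_act A g) (graph 0 0 (2^-1 *: (X ^+ 2 + Y ^+ 2))).
Proof.
have [A [T [/same_jet3_graph0[phi rphi [h0 h1 h2]] /cubic_taylor]]] := hg.
move=> [c0 [c1 [c2 [c3 hT]]]].
(* Found by comparing coefficients with (l1 x + l2 y)(x^2 + y^2)/2 + p(x^3 - 3xy^2) + r(3x^2 y -
   y^3). *)
pose p := (c0 - c2) / 4; pose r := (c1 - c3) / 4.
pose l1 := 2 * (c0 - p); pose l2 := 2 * (c3 + r).
have [t [mu [ep er]]] := harmonic_cubic_axis p r.
(* Composites are compared on parametrizations, since a germ also carries a proof of immersivity. *)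
have comp (B : aff3 R) : exists BA : aff3 R, forall h : 'cV[{mpoly R[2]}]_3,
    aff_param BA h = aff_param B (aff_param A h).
  have uBA : aff_lin B *m aff_lin A \in unitmx.
    by rewrite unitmx_mul !aff_unit.
  exists (Aff3 (aff_lin B *m aff_trans A + aff_trans B) uBA) => h.
  by rewrite /aff_param /= map_mxM map_mxD map_mxM mulmxDr mulmxA addrA.
have [lam [k [lam0 emu k01]]] : exists lam k : R,
    [/\ lam != 0, mu = lam * k & k = 6^-1 \/ k = 0].
  (* If [mu] is 0, no cubic part is left and any nonzero [lam] would do; otherwise [lam] = 6 [mu]
     brings the coefficient to 1/6. *)
  have [->|mu0] := eqVneq mu 0.
    by exists 1, 0; split; rewrite ?oner_eq0 ?mulr0 //; right.
  by exists (6 * mu), 6^-1; split; [rewrite mulf_neq0 ?pnatr_eq0|field|left].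
rewrite emu in ep er.
have [|B hB] := normalize_cubic (l1 := l1) (l2 := l2) rphi h0 h1 _ lam0 ep er.
  apply: (taylor_eq_trans h2); have vphi i : vanishes 1 (phi i 0).
    by apply: vanishes1P; have [] := rphi.
  apply: (taylor_eq_trans (taylor_eq_substitutel vphi hT)).
  set Z := (X in taylor_eq _ _ X); suff -> : substitute
    (elliptic_quadric + (c0 *: X ^+ 3 + c1 *: (X ^+ 2 * Y)
                         + c2 *: (X * Y ^+ 2) + c3 *: Y ^+ 3)) phi = Z by [].
  have -> : c0 = 2^-1 * l1 + p by rewrite /l1 mulKf ?pnatr_eq0 // subrK.
  have -> : c1 = 2^-1 * l2 + 3 * r by rewrite /l2 /r; field.
  have -> : c2 = 2^-1 * l1 - 3 * p by rewrite /l1 /p; field.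
  have -> : c3 = 2^-1 * l2 - r by rewrite /l2 mulKf ?pnatr_eq0 // addrK.
  rewrite /Z /elliptic_quadric -!mul_mpolyC !(mpolyCD, mpolyCN, mpolyCM).
  rewrite /substitute !(rmorphD, rmorphN, rmorphXn, rmorphM, rmorph_nat) /=.
  rewrite !comp_mpolyC -!/(substitute _ phi) substituteX substituteY.
  move: (phi ord0 0) (phi ord_max 0) => P Q; ring.
have [BA eBA] := comp B; exists BA.
have {}hB : same_jet3 (aff_act BA g) (graph 0 0
    (2^-1 *: (X ^+ 2 + Y ^+ 2) + k *: (X ^+ 3 - 3 *: (X * Y ^+ 2)))).
  by case: hB => psi rpsi h; exists psi => // i; rewrite /= eBA; apply: h.
by case: k01 hB => ->; [left|rewrite scale0r addr0; right].
Qed.
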